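(* Let $k$ be an algebraically closed field of characteristic $2$ and let $G$ be a finite group of even order. Let $M$ be an indecomposable $kG$-module which has symmetric type, let $T$ be a symmetric vertex of $M$ and let $B$ be a $T$-projective $G$-form on $M$. Then for every subgroup $H\leq G$, $B$ is $H$-projective if and only if $T$ is $G$-conjugate to a subgroup of $H$.
   Context: All modules are finite-dimensional left modules. A $G$-form on a $kG$-module $M$ is a non-degenerate $G$-invariant symmetric bilinear form $B:M\times M\to k$; then $(M,B)$ is called a symmetric $kG$-module and $M$ is said to have symmetric type. A $kG$-isometry is a $kG$-homomorphism preserving the forms; $(L,B_L)$ is a component of $(M,B)$ if there is a $kG$-isometry $(L,B_L)\to(M,B)$ (its image is then an orthogonal direct summand). For $H\le G$ and a symmetric $kH$-module $(L,B_L)$, $\mathrm{Ind}_H^G(L,B_L)$ is $\mathrm{Ind}_H^G L$ with the induced $G$-form $B_L^G(g_1\otimes \ell_1,g_2\otimes \ell_2)=B_L(g_2^{-1}g_1\ell_1,\ell_2)$ if $g_1H=g_2H$ and $0$ otherwise. A $G$-form $B$ on $M$ is $H$-projective if $(M,B)$ is a component of $\mathrm{Ind}_H^G(L,B_L)$ for some symmetric $kH$-module $(L,B_L)$. $M$ is symmetrically $H$-projective if it affords an $H$-projective $G$-form. If $M$ is indecomposable, a symmetric vertex of $M$ is a subgroup $T$ of $G$ that is minimal (under inclusion) subject to $M$ being symmetrically $T$-projective. *)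

(* Defs.v *)
From mathcomp Require Import all_boot all_order all_algebra all_fingroup.
From mathcomp Require Export mxrepresentation.

Set Implicit Arguments.
Unset Strict Implicit.
Unset Printing Implicit Defensive.

Import GRing.Theory GroupScope.
Local Open Scope ring_scope.

(* A finite-dimensional left kG-module is a matrix representation             *)
(* rM : mx_representation k G n acting on COLUMN vectors, g . v = rM g *m v.  *)
(* (The submodule theory of mxrepresentation uses row vectors, hence right    *)
(* modules; it is not used here.)                                             *)

Section Modules.

Variables (k : fieldType) (gT : finGroupType) (G : {group gT}).

Definition submodule n (rM : mx_representation k G n)
    (U : {vspace 'cV[k]_n}) : Prop :=
  forall (g : gT) (v : 'cV[k]_n), g \in G -> v \in U -> rM g *m v \in U.

Definition indecomposable n (rM : mx_representation k G n) : Prop :=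
  (0 < n)%N /\
  forall U W : {vspace 'cV[k]_n}, submodule rM U -> submodule rM W ->
    (U + W)%VS = fullv -> (U :&: W)%VS = 0%VS -> U = 0%VS \/ W = 0%VS.

(* The bilinear form on column vectors with Gram matrix B.                    *)
Definition bform n (B : 'M[k]_n) (u v : 'cV[k]_n) : k := (u^T *m B *m v) 0 0.

Definition Gform n (rM : mx_representation k G n) (B : 'M[k]_n) : Prop :=
  [/\ forall u v, bform B u v = bform B v u,
      forall u, (forall v, bform B u v = 0) -> u = 0
    & forall g, g \in G ->
        forall u v, bform B (rM g *m u) (rM g *m v) = bform B u v].

Definition symmetric_type n (rM : mx_representation k G n) : Prop :=
  exists B, Gform rM B.

(* X is the matrix of a kG-isometry (L, BL) -> (M, BM).                       *)
Definition kGisometry m n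
    (rL : mx_representation k G m) (BL : 'M[k]_m)
    (rM : mx_representation k G n) (BM : 'M[k]_n) (X : 'M[k]_(n, m)) : Prop :=
  (forall g, g \in G -> forall u : 'cV[k]_m,
     X *m (rL g *m u) = rM g *m (X *m u)) /\
  (forall u v, bform BM (X *m u) (X *m v) = bform BL u v).

Definition component m n
    (rL : mx_representation k G m) (BL : 'M[k]_m)
    (rM : mx_representation k G n) (BM : 'M[k]_n) : Prop :=
  exists X : 'M[k]_(n, m), kGisometry rL BL rM BM X.

End Modules.

(* Induction from H to G, as the direct sum of the t_i (x) L over             *)
(* representatives t_i of the left cosets t_i H in G.                         *)

Section Induction.

Variables (k : fieldType) (gT : finGroupType) (G H : {group gT}).

Definition coset_rep (i : 'I_#|lcosets H G|) : gT := repr (enum_val i).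

Lemma coset_repK i : (coset_rep i *: H)%g = enum_val i.
Proof.
rewrite /coset_rep; have /lcosetsP[x _ ->] := enum_valP i.
by apply/lcoset_eqP; apply: mem_repr (lcoset_refl H x).
Qed.

Lemma mem_coset_rep i g :
  ((coset_rep i)^-1 * g \in H)%g = (g *: H == enum_val i)%g.
Proof.
by rewrite -mem_lcoset -coset_repK (sameP lcoset_eqP eqP) eq_sym.
Qed.

Lemma coset_rep_in i : exists2 x, x \in G & (coset_rep i *: H = x *: H)%g.
Proof. by rewrite coset_repK; apply/lcosetsP/enum_valP. Qed.

Lemma coset_rep_ex x g : x \in G -> g \in (G * H)%g ->
  exists i : 'I_#|lcosets H G|, ((x * g) *: H)%g = enum_val i.
Proof.
move=> Gx /mulsgP[y h Gy Hh ->].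
have HG: ((x * (y * h)) *: H)%g \in lcosets H G.
  apply/lcosetsP; exists (x * y)%g; first exact: groupM.
  by rewrite mulgA lcosetM (lcoset_id Hh).
by exists (enum_rank_in HG ((x * (y * h)) *: H)%g); rewrite enum_rankK_in.
Qed.

Lemma coset_rep_mem i : coset_rep i \in (G * H)%g.
Proof.
have [x Gx /lcoset_eqP/lcosetP[h Hh ->]] := coset_rep_in i.
exact: mem_mulg.
Qed.

Section Module.

Variables (m : nat) (rL : mx_representation k H m).

Definition ext_repr (x : gT) : 'M[k]_m := if x \in H then rL x else 0.

Lemma ext_reprM x y : y \in H -> ext_repr (x * y)%g = ext_repr x *m rL y.
Proof.
rewrite /ext_repr => Hy; rewrite groupMr //.
by case: ifP => Hx; rewrite ?mul0mx // repr_mxM.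
Qed.

(* x t_j (x) l = t_i (x) (t_i^-1 x t_j) l, where x t_j lies in t_i H.         *)
Definition ind_mx (x : gT) : 'M[k]_(\sum_(i < #|lcosets H G|) m) :=
  \mxblock_(i < #|lcosets H G|, j < #|lcosets H G|)
    ext_repr ((coset_rep i)^-1 * x * coset_rep j)%g.

(* The element g (x) l of the induced module.                                 *)
Definition tensor (g : gT) (l : 'cV[k]_m)
    : 'cV[k]_(\sum_(i < #|lcosets H G|) m) :=
  \mxcol_(i < #|lcosets H G|) (ext_repr ((coset_rep i)^-1 * g)%g *m l).

Lemma ext_repr_sum x g i : x \in G -> g \in (G * H)%g ->
  \sum_j ext_repr ((coset_rep i)^-1 * x * coset_rep j)%g
           *m ext_repr ((coset_rep j)^-1 * g)%g
  = ext_repr ((coset_rep i)^-1 * (x * g))%g.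
Proof.
move=> Gx GHg; have [j Dj] := coset_rep_ex (group1 G) GHg.
rewrite mul1g in Dj.
have Hj: ((coset_rep j)^-1 * g \in H)%g by rewrite mem_coset_rep Dj.
rewrite (bigD1 j) //= big1 ?addr0 => [|i' ne_i'j].
  rewrite {2}/ext_repr Hj -ext_reprM //; congr ext_repr.
  by rewrite !mulgA mulgK.
rewrite {2}/ext_repr mem_coset_rep Dj (inj_eq enum_val_inj) eq_sym.
by rewrite (negPf ne_i'j) mulmx0.
Qed.

Lemma ind_mx_repr : mx_repr G ind_mx.
Proof.
split=> [|x y Gx Gy].
  rewrite -mxdiagZ; apply: eq_mxblock => i j.
  rewrite /ext_repr mulg1 mem_coset_rep coset_repK (inj_eq enum_val_inj) eq_sym.
  case: eqP => [->|_] //.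
  by rewrite mulVg repr_mx1 conform_mx_id.
rewrite /ind_mx mul_mxblock; apply: eq_mxblock => i j; rewrite -mulgA.
have GHj: (y * coset_rep j)%g \in (G * H)%g.
  have /mulsgP[z h Gz Hh ->] := coset_rep_mem j.
  by rewrite mulgA mem_mulg ?groupM.
rewrite -mulgA -ext_repr_sum //; apply: eq_bigr => l _.
by rewrite !mulgA.
Qed.

Definition ind_repr := MxRepresentation ind_mx_repr.

Definition ind_form (B : 'M[k]_m) : 'M[k]_(\sum_(i < #|lcosets H G|) m) :=
  \mxdiag_(i < #|lcosets H G|) B.

(* tensorM, ind_repr_tensor and tensor_span: ind_repr is kG (x)_{kH} L.       *)
(* ind_form_tensor: ind_form is the induced form on the elements g (x) l.     *)
Lemma tensorM g h l : h \in H -> tensor (g * h)%g l = tensor g (rL h *m l).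
Proof.
by move=> Hh; apply: eq_mxcol => i; rewrite mulgA ext_reprM // mulmxA.
Qed.

Lemma ind_repr_tensor x g l : x \in G -> g \in G ->
  ind_repr x *m tensor g l = tensor (x * g)%g l.
Proof.
move=> Gx Gg; rewrite /ind_repr /= mul_mxblock_mxrow; apply: eq_mxcol => i.
rewrite -ext_repr_sum //; last by rewrite -[g]mulg1 mem_mulg.
by rewrite mulmx_suml; apply: eq_bigr => j _; rewrite mulmxA.
Qed.

Lemma tensor_span (v : 'cV[k]_(\sum_(i < #|lcosets H G|) m)) :
  v = \sum_i tensor (coset_rep i) (submxcol v i).
Proof.
rewrite -mxcol_sum -[LHS]submxcolK; apply: eq_mxcol => i.
rewrite (bigD1 i) //= big1 => [|j ne_ji].
  by rewrite addr0 mulVg /ext_repr group1 repr_mx1 mul1mx.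
rewrite /ext_repr mem_coset_rep coset_repK (inj_eq enum_val_inj).
by rewrite (negPf ne_ji) mul0mx.
Qed.

Lemma bform_ind B u v :
  bform (ind_form B) u v = \sum_i bform B (submxcol u i) (submxcol v i).
Proof.
rewrite /bform /ind_form -{1}[u]submxcolK -{1}[v]submxcolK.
rewrite tr_mxcol mul_mxrow_mxdiag mul_mxrow_mxcol summxE.
by apply: eq_bigr.
Qed.

Lemma bform0l n (B : 'M[k]_n) v : bform B 0 v = 0.
Proof. by rewrite /bform trmx0 !mul0mx mxE. Qed.

Lemma bform0r n (B : 'M[k]_n) u : bform B u 0 = 0.
Proof. by rewrite /bform mulmx0 mxE. Qed.

Lemma ind_form_tensor B g1 g2 l1 l2 : Gform rL B -> g1 \in G -> g2 \in G ->
  bform (ind_form B) (tensor g1 l1) (tensor g2 l2) =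
  if (g1 *: H == g2 *: H)%g then bform B (rL (g2^-1 * g1)%g *m l1) l2 else 0.
Proof.
move=> [_ _ invB] Gg1 Gg2; rewrite bform_ind.
have GH2: g2 \in (G * H)%g by rewrite -[g2]mulg1 mem_mulg.
have [j] := coset_rep_ex (group1 G) GH2; rewrite mul1g => Dj.
rewrite (bigD1 j) //= big1 => [|i ne_ij]; last first.
  rewrite !mxcolK [X in bform _ _ (X *m _)]/ext_repr mem_coset_rep Dj.
  by rewrite (inj_eq enum_val_inj) eq_sym (negPf ne_ij) mul0mx bform0r.
rewrite addr0 !mxcolK /ext_repr !mem_coset_rep Dj eqxx.
case: eqP => [Dj1|_]; last by rewrite mul0mx bform0l.
have Ht: ((coset_rep j)^-1 * g2 \in H)%g by rewrite mem_coset_rep Dj.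
have Hg: (g2^-1 * g1 \in H)%g.
  by rewrite -mem_lcoset Dj -Dj1 lcoset_refl.
by rewrite -[RHS](invB _ Ht) [in RHS]mulmxA -repr_mxM // !mulgA mulgK.
Qed.

Lemma Gform_ind B : H \subset G -> Gform rL B -> Gform ind_repr (ind_form B).
Proof.
move=> sHG GfB; have [symB ndB _] := GfB.
have Gt i : coset_rep i \in G by rewrite -(mulGSid sHG) coset_rep_mem.
have bform_sum (I : finType) (F1 F2 : I -> _) :
    bform (ind_form B) (\sum_i F1 i) (\sum_i F2 i)
  = \sum_i \sum_j bform (ind_form B) (F1 i) (F2 j).
  rewrite /bform [(\sum_i F1 i)^T]raddf_sum !mulmx_suml summxE.
  by apply: eq_bigr => i _; rewrite mulmx_sumr summxE.
split=> [u v | u ker_u | x Gx u v].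
- by rewrite !bform_ind; apply: eq_bigr => i _; apply: symB.
- rewrite [u]tensor_span; apply: big1 => i _.
  suffices ->: submxcol u i = 0.
    rewrite /tensor -[RHS]submxcolK; apply: eq_mxcol => j.
    by rewrite mulmx0 submxcol0.
  apply: ndB => v; have := ker_u (tensor (coset_rep i) v).
  rewrite bform_ind (bigD1 i) //= big1 => [|j ne_ji].
    by rewrite addr0 mxcolK mulVg /ext_repr group1 repr_mx1 mul1mx.
  rewrite mxcolK /ext_repr mem_coset_rep coset_repK (inj_eq enum_val_inj).
  by rewrite eq_sym (negPf ne_ji) mul0mx bform0r.
rewrite [u]tensor_span [v]tensor_span !mulmx_sumr !bform_sum.
apply: eq_bigr => i _; apply: eq_bigr => j _.
rewrite !ind_repr_tensor // !ind_form_tensor ?groupM // !lcosetM.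
have xI (A1 A2 : {set gT}) : (x *: A1 == x *: A2)%g = (A1 == A2).
  by apply/eqP/eqP => [/lcoset_inj|->].
by rewrite xI invMg -mulgA mulKg.
Qed.

End Module.
End Induction.

Section Projectivity.

Variables (k : fieldType) (gT : finGroupType) (G : {group gT}).
Variables (n : nat) (rM : mx_representation k G n).

Definition form_projective (B : 'M[k]_n) (H : {group gT}) : Prop :=
  exists m (rL : mx_representation k H m) (BL : 'M[k]_m),
    Gform rL BL /\ component rM B (ind_repr G rL) (ind_form G H BL).

Definition symmetrically_projective (H : {group gT}) : Prop :=
  exists B, Gform rM B /\ form_projective B H.

Definition symmetric_vertex (T : {group gT}) : Prop :=
  [/\ T \subset G, symmetrically_projective T
    & forall S : {group gT},
        S \subset T -> symmetrically_projective S -> S :=: T].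

End Projectivity.

(* Main.v *)
Require Import Defs.
From mathcomp Require Import all_boot all_order all_algebra all_fingroup.
From Stdlib Require Import Classical_Prop.
Set Implicit Arguments.
Unset Strict Implicit.
Unset Printing Implicit Defensive.
Import GRing.Theory GroupScope.
Local Open Scope ring_scope.

(** Fix B, let E = End_k(M) with G acting by conjugation, and let sigma be the
    adjoint involution of E with respect to B.  Writing a form as B(x u, v)
    turns H-invariant forms into elements x of E^H and symmetric forms into
    self-adjoint elements.  An H-invariant symmetric form on M, degenerate or
    not, is always the restriction of a non-degenerate one on M + M; hence B is
    H-projective exactly when it is a trace from H of such a form, that is, when
    1 = Tr_H^G(y) for a self-adjoint y in E^H ([form_projective_trace],
    [trace_form_projective]).

    Since M is indecomposable and k algebraically closed, E^G = k + J where J,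
    the set of singular elements, is an ideal; in characteristic 2 this gives
    x + sigma(x) in J for all x in E^G ([singular_add_adjoint]).  So in a sum of
    elements of E^G over a set with an involution i such that F(i c) =
    sigma(F(c)), only the fixed points of i matter modulo J
    ([unit_fixed_point]).

    Let V be minimal with 1 = Tr_V^G(z) for some z in E^V, not necessarily
    self-adjoint: V is a vertex of M.  By minimality, in a sum over cosets to
    which Tr_V^G is applied, the cosets that are not fixed by V contribute
    elements of J ([tr_fixed_unit]).  This is used twice.

    - 1 = Tr_V^G(sigma(z) Tr_V^G(z)) is congruent modulo J to the sum of
      Tr_V^G(sigma(z) z^h) over the V-fixed cosets Vh, those with h in N(V).
      Inverting Vh applies sigma to its term, so there is h in N(V) with h^2 in
      V and Tr_V^G(sigma(z) z^h) a unit ([exists_swap]).  Put D = <V, h> and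
      w = sigma(z) z^h.  Then sigma(w) = w^h, so Tr_V^D(w) is self-adjoint and
      M affords a D-projective form ([swap_trace]).

    - If 1 = Tr_K^G(y) with y in E^K self-adjoint, then
      Tr_V^G(sigma(z) 1 z^h) is congruent to the sum over the V-fixed cosets
      C = Kc of Tr_V^G(sigma(z) y^c z^h).  Right multiplication of C by h
      applies sigma to its term, so some coset Kc is fixed by V and by h, that is, D
      lies in K^c ([fixed_by_swap]).

    Thus D lies in a conjugate of every K for which B is K-projective.  For
    K = T the minimality of T makes D conjugate to T, and K = H concludes. *)

(** * The conjugation action on endomorphisms and relative traces *)

Section RelativeTrace.

Variables (k : fieldType) (gT : finGroupType) (G : {group gT}).
Variables (n : nat) (rM : mx_representation k G n).
Implicit Types (x y : 'M[k]_n) (g h : gT) (H K V : {group gT}).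

(** A right action, to match right cosets and the conjugation of subgroups. *)
Definition endo_act x g : 'M[k]_n := rM g^-1%g *m x *m rM g.

Definition equivariant K x := forall g, g \in K -> endo_act x g = x.

Definition rel_trace K H x : 'M[k]_n :=
  \sum_(C in rcosets K H) endo_act x (repr C).

Lemma endo_act1 x : endo_act x 1%g = x.
Proof. by rewrite /endo_act invg1 !repr_mx1 mulmx1 mul1mx. Qed.

Lemma endo_actM x g h :
  g \in G -> h \in G -> endo_act x (g * h)%g = endo_act (endo_act x g) h.
Proof.
by move=> Gg Gh; rewrite /endo_act invMg !repr_mxM ?groupV // !mulmxA.
Qed.

Lemma endo_act_mul x y g :
  g \in G -> endo_act (x *m y) g = endo_act x g *m endo_act y g.
Proof.
by move=> Gg; rewrite /endo_act !mulmxA repr_mxK.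
Qed.

Lemma endo_actD x y g : endo_act (x + y) g = endo_act x g + endo_act y g.
Proof. by rewrite /endo_act mulmxDr mulmxDl. Qed.

Lemma endo_act_sum (I : finType) (P : pred I) (F : I -> 'M_n) g :
  endo_act (\sum_(i | P i) F i) g = \sum_(i | P i) endo_act (F i) g.
Proof. by rewrite /endo_act mulmx_sumr mulmx_suml. Qed.

Lemma equivariantP x :
  equivariant G x <-> forall g, g \in G -> rM g *m x = x *m rM g.
Proof.
split=> invx g Gg.
  by rewrite -[in LHS](invx g Gg) /endo_act !mulmxA -repr_mxM ?groupV //
             mulgV repr_mx1 mul1mx.
by rewrite /endo_act -mulmxA -invx // mulmxA -repr_mxM ?groupV // mulVg
           repr_mx1 mul1mx.
Qed.

Lemma equivariantS K H x : K \subset H -> equivariant H x -> equivariant K x.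
Proof. by move=> sKH invx g Kg; apply/invx/(subsetP sKH). Qed.

Lemma equivariant1 K : K \subset G -> equivariant K 1%:M.
Proof.
move=> sKG g /(subsetP sKG) Gg.
by rewrite /endo_act mulmx1 -repr_mxM ?groupV // mulVg repr_mx1.
Qed.

Lemma equivariantM K x y :
  K \subset G -> equivariant K x -> equivariant K y -> equivariant K (x *m y).
Proof.
move=> sKG invx invy g Kg.
by rewrite endo_act_mul ?(subsetP sKG) // invx // invy.
Qed.

Lemma equivariantD K x y :
  equivariant K x -> equivariant K y -> equivariant K (x + y).
Proof. by move=> invx invy g Kg; rewrite endo_actD invx // invy. Qed.

Lemma equivariant_sum K (I : finType) (P : pred I) (F : I -> 'M_n) :
  (forall i, P i -> equivariant K (F i)) -> equivariant K (\sum_(i | P i) F i).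
Proof.
by move=> invF g Kg; rewrite endo_act_sum; apply: eq_bigr => i /invF ->.
Qed.

Lemma equivariant_conj K x g : K \subset G -> g \in G ->
  equivariant K x -> equivariant (K :^ g) (endo_act x g).
Proof.
move=> sKG Gg invx _ /imsetP[h Kh ->]; have Gh := subsetP sKG h Kh.
by rewrite -endo_actM ?groupJ // -conjgC endo_actM // invx.
Qed.

(** Hence the summands of [rel_trace] do not depend on the representatives. *)
Lemma endo_act_rcoset K x g : K \subset G -> equivariant K x -> g \in G ->
  endo_act x (repr (K :* g)) = endo_act x g.
Proof.
move=> sKG invx Gg; case: repr_rcosetP => h Kh; have Gh := subsetP sKG h Kh.
by rewrite endo_actM // invx.
Qed.

Lemma repr_rcosets_in K H C :
  K \subset H -> C \in rcosets K H -> repr C \in H.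
Proof.
move=> sKH /rcosetsP[h Hh ->]; case: repr_rcosetP => a Ka.
by rewrite groupM ?(subsetP sKH a).
Qed.

Lemma endo_act_rcosetM K x C h : K \subset G -> equivariant K x ->
  C \in rcosets K G -> h \in G ->
  endo_act x (repr (C :* h)) = endo_act (endo_act x (repr C)) h.
Proof.
move=> sKG invx /rcosetsP[g Gg ->] Gh.
by rewrite -rcosetM !endo_act_rcoset ?groupM // endo_actM.
Qed.

Lemma rcoset_in_rcosets K H h : h \in H -> K :* h \in rcosets K H.
Proof. by move=> Hh; apply/rcosetsP; exists h. Qed.

Lemma mem_rcosetsM K H C h :
  C \in rcosets K H -> h \in H -> C :* h \in rcosets K H.
Proof.
by move=> /rcosetsP[g Hg ->] Hh; rewrite -rcosetM rcoset_in_rcosets ?groupM.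
Qed.

Lemma rel_trace_equivariant K H x : K \subset H -> H \subset G ->
  equivariant K x -> equivariant H (rel_trace K H x).
Proof.
move=> sKH sHG invx h Hh; have sKG := subset_trans sKH sHG.
rewrite endo_act_sum.
rewrite [RHS](reindex_onto (fun C => C :* h) (fun C => C :* h^-1%g)) /=;
  last by move=> C _; rewrite -rcosetM mulVg rcoset1.
apply: eq_big => C.
  rewrite -rcosetM mulgV rcoset1 eqxx andbT; apply/idP/idP => KC.
    exact: mem_rcosetsM.
  by rewrite -[C]rcoset1 -(mulgV h) rcosetM mem_rcosetsM ?groupV.
case/rcosetsP=> g Hg ->; have [Gg Gh] := (subsetP sHG g Hg, subsetP sHG h Hh).
by rewrite -(endo_act_rcosetM sKG invx) // rcoset_in_rcosets.
Qed.

Lemma rel_traceD K H x y :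
  rel_trace K H (x + y) = rel_trace K H x + rel_trace K H y.
Proof. by rewrite -big_split; apply: eq_bigr => C _; rewrite endo_actD. Qed.

Lemma rel_trace_sum K H (I : finType) (P : pred I) (F : I -> 'M_n) :
  rel_trace K H (\sum_(i | P i) F i) = \sum_(i | P i) rel_trace K H (F i).
Proof.
by rewrite exchange_big; apply: eq_bigr => C _; rewrite endo_act_sum.
Qed.

Lemma rel_traceMr K H x y : K \subset H -> H \subset G -> equivariant H y ->
  rel_trace K H (x *m y) = rel_trace K H x *m y.
Proof.
move=> sKH sHG invy; rewrite mulmx_suml; apply: eq_bigr => C KC.
have HC := repr_rcosets_in sKH KC; have GC := subsetP sHG _ HC.
by rewrite endo_act_mul // invy.
Qed.

Lemma rel_trace_trans K H x : K \subset H -> H \subset G -> equivariant K x ->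
  rel_trace H G (rel_trace K H x) = rel_trace K G x.
Proof.
move=> sKH sHG invx; have sKG := subset_trans sKH sHG.
have mulHK g : (H * (K :* g))%g = H :* g by rewrite mulgA (mulGSid sKH).
(* Group the cosets of K by the coset of H that contains them. *)
rewrite [RHS](partition_big (fun C => H * C)%g (mem (rcosets H G))) /=;
  last by move=> _ /rcosetsP[g Gg ->]; rewrite mulHK rcoset_in_rcosets.
apply: eq_bigr => _ /rcosetsP[g Gg ->].
rewrite endo_act_rcoset //; last exact: rel_trace_equivariant.
rewrite endo_act_sum.
rewrite [RHS](reindex_onto (fun C => C :* g) (fun C => C :* g^-1%g)) /=;
  last by move=> C _; rewrite -rcosetM mulVg rcoset1.
apply: eq_big => C.
  rewrite -rcosetM mulgV rcoset1 eqxx andbT.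
  apply/idP/idP => [/rcosetsP[h Hh ->]|].
    have Gh := subsetP sHG h Hh; rewrite -rcosetM mulHK [H :* _]rcosetM.
    by rewrite (rcoset_id Hh) eqxx rcoset_in_rcosets ?groupM.
  case/andP=> /rcosetsP[h Gh DC] /eqP.
  have ->: C = K :* (h * g^-1)%g by rewrite rcosetM -DC -rcosetM mulgV rcoset1.
  rewrite -rcosetM mulgKV mulHK => HC; rewrite rcoset_in_rcosets //.
  by rewrite -mem_rcoset -HC rcoset_refl.
case/rcosetsP=> h Hh ->; have Gh := subsetP sHG h Hh.
by rewrite -(endo_act_rcosetM sKG invx) // rcoset_in_rcosets.
Qed.

Lemma rel_trace_conj K H x g : K \subset H -> H \subset G -> g \in H ->
  equivariant K x -> rel_trace (K :^ g) H (endo_act x g) = rel_trace K H x.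
Proof.
move=> sKH sHG Hg invx; have sKG := subset_trans sKH sHG.
have Gg := subsetP sHG g Hg.
rewrite [LHS](reindex_onto (fun C => (g^-1 *: C)%g) (fun C => (g *: C)%g)) /=;
  last by move=> C _; rewrite -lcosetM mulVg lcoset1.
have KgE h : (g^-1 *: (K :* h) = (K :^ g) :* (g^-1 * h))%g.
  by rewrite conjsgE -!mulgA mulg_set1 mulKVg.
have KE h : ((K :^ g) :* h = g^-1 *: (K :* (g * h)))%g by rewrite KgE mulKg.
apply: eq_big => C.
  rewrite -lcosetM mulgV lcoset1 eqxx andbT; apply/idP/idP.
    case/rcosetsP=> h Hh; rewrite KE => /lcoset_inj ->.
    by rewrite rcoset_in_rcosets ?groupM.
  by case/rcosetsP=> h Hh ->; rewrite KgE rcoset_in_rcosets ?groupM ?groupV.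
rewrite -lcosetM mulgV lcoset1 eqxx andbT.
case/rcosetsP=> h Hh; rewrite KE => /lcoset_inj ->.
have Gh := subsetP sHG h Hh; rewrite KgE mulKg.
have sKgG: K :^ g \subset G by rewrite -(conjGid Gg) conjSg.
rewrite (endo_act_rcoset sKgG) //; last exact: equivariant_conj.
by rewrite endo_act_rcoset ?groupM // endo_actM.
Qed.

(** This produces the inner traces of a Mackey decomposition: a trace from K to
    G is a sum over the cosets of K, and V permutes these. *)
Lemma sum_orbit_rel_trace (rT : finType) (to : {action gT &-> rT}) V
    (f : rT -> 'M[k]_n) c :
  V \subset G ->
  (forall d v, d \in orbit to V c -> v \in V ->
     f (to d v) = endo_act (f d) v) ->
  \sum_(d in orbit to V c) f d = rel_trace 'C_V[c | to] V (f c).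
Proof.
move=> sVG fV; rewrite (orbit_stabilizer to c (subsetT V)) big_imset /=.
  apply: eq_bigr => C KC; rewrite fV ?orbit_refl //.
  exact: repr_rcosets_in (subsetIl V _) KC.
exact: can_in_inj (act_reprK (subsetT V)).
Qed.

End RelativeTrace.

(** * Endomorphisms of an indecomposable module *)

Section LocalEndomorphisms.

Variables (k : fieldType) (gT : finGroupType) (G : {group gT}).

Lemma eq_mulmx_cV m n (X Y : 'M[k]_(m, n)) :
  (forall v : 'cV_n, X *m v = Y *m v) -> X = Y.
Proof.
move=> eqXY; apply/matrixP=> i j.
by have /matrixP/(_ i 0) := eqXY (delta_mx j 0); rewrite -!colE !mxE.
Qed.

Lemma equivariant_inv n (rM : mx_representation k G n) (K : {group gT}) x :
  K \subset G -> equivariant rM K x -> equivariant rM K (invmx x).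
Proof.
move=> sKG invx; have [Ux | nUx] := boolP (x \in unitmx);
  last by rewrite invmx_out.
move=> g Kg; have Gg := subsetP sKG g Kg.
apply: (can_inj (mulKmx Ux)).
rewrite mulmxV // -{1}(invx g Kg) -endo_act_mul // mulmxV //.
exact: equivariant1 sKG g Kg.
Qed.

Lemma equivariant_scalar n (rM : mx_representation k G n) c :
  equivariant rM G c%:M.
Proof. by apply/equivariantP=> g _; rewrite scalar_mxC. Qed.

Lemma horner_mx_equivariant n (rM : mx_representation k G n.+1) a p :
  equivariant rM G a -> equivariant rM G (horner_mx a p).
Proof.
move=> /equivariantP inva; apply/equivariantP=> g Gg.
exact: comm_mx_horner (inva g Gg).
Qed.

Lemma ker_submodule n (rM : mx_representation k G n) (a : 'M_n) :
  equivariant rM G a -> submodule rM (lker (linfun (mulmx a))).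
Proof.
move=> /equivariantP inva g v Gg; rewrite !memv_ker !lfunE /= => /eqP av0.
by rewrite mulmxA -inva // -mulmxA av0 mulmx0.
Qed.

(** Fitting's lemma: the characteristic polynomial of a is q * 'X^m with q prime
    to 'X, so M is the direct sum of the kernels of a^m and q(a).  As a is
    singular, indecomposability makes a nilpotent. *)
Lemma indecomposable_sub1_unit n (rM : mx_representation k G n) (a : 'M_n) :
  indecomposable rM -> equivariant rM G a -> a \notin unitmx ->
  1%:M - a \in unitmx.
Proof.
case: n rM a => [|n] rM a [// _ indM] inva nUa.
have root0: root (char_poly a) 0.
  rewrite -eigenvalue_root_char /eigenvalue /eigenspace.
  by rewrite raddf0 subr0 kermx_eq0 row_free_unit.
have [m [q q0 Dp]] := multiplicity_XsubC (char_poly a) 0.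
have {}q0: ~~ root q 0.
  by apply: implyP q0 _; rewrite monic_neq0 ?char_poly_monic.
have Dm: (0 < m)%N.
  by case: m Dp => // Dp; move: root0; rewrite Dp mulr1 (negPf q0).
have /Bezout_eq1_coprimepP[[u v] /= Duv]: coprimep q (('X - 0%:P) ^+ m).
  by rewrite coprimep_expr // coprimep_XsubC.
pose Q := horner_mx a q; pose A := horner_mx a (('X - 0%:P) ^+ m).
have QA0: Q *m A = 0.
  by rewrite -[_ *m _]rmorphM -Dp; apply: Cayley_Hamilton.
have AQ0: A *m Q = 0.
  by rewrite -[_ *m _]rmorphM mulrC -Dp; apply: Cayley_Hamilton.
have DA: A = a ^+ m by rewrite /A subr0 rmorphXn /= horner_mx_X.
have D1 (w : 'cV_n.+1) :
    w = Q *m (horner_mx a u *m w) + A *m (horner_mx a v *m w).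
  rewrite !mulmxA -mulmxDl -![_ *m horner_mx a _]rmorphM -rmorphD /=.
  by rewrite mulrC [X in _ + X]mulrC Duv rmorph1 mul1mx.
have inva_ p := horner_mx_equivariant p inva.
have [||||U0|W0] := indM (lker (linfun (mulmx A))) (lker (linfun (mulmx Q))).
- exact/ker_submodule/inva_.
- exact/ker_submodule/inva_.
- apply/eqP; rewrite eqEsubv subvf; apply/subvP=> w _; rewrite (D1 w).
  by apply: memv_add; rewrite memv_ker lfunE /= !mulmxA ?QA0 ?AQ0 !mul0mx.
- apply/eqP; rewrite -subv0; apply/subvP=> w.
  rewrite memv_cap !memv_ker !lfunE /=.
  case/andP=> /eqP Aw0 /eqP Qw0; rewrite memv0 (D1 w) !mulmxA.
  have comm p r :
      horner_mx a p *m horner_mx a r = horner_mx a r *m horner_mx a p.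
    by rewrite -[LHS]rmorphM -[RHS]rmorphM mulrC.
  by rewrite (comm q) (comm (_ ^+ _)) -!mulmxA Aw0 Qw0 !mulmx0 addr0.
- have Q0: Q = 0.
    apply: eq_mulmx_cV => w; apply/eqP.
    rewrite mul0mx -memv0 -U0 memv_ker lfunE /=.
    by rewrite mulmxA AQ0 mul0mx.
  have uA: horner_mx a v *m A = 1%:M.
    transitivity (horner_mx a (u * q + v * ('X - 0%:P) ^+ m)).
      by rewrite rmorphD !rmorphM /= -/Q Q0 mulr0 add0r.
    by rewrite Duv rmorph1.
  by case/negP: nUa; have [_] := mulmx1_unit uA; rewrite DA unitrX_pos.
have A0: a ^+ m = 0.
  apply: eq_mulmx_cV => w; apply/eqP.
  rewrite mul0mx -memv0 -W0 memv_ker lfunE /=.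
  by rewrite mulmxA -DA QA0 mul0mx.
rewrite -unitrN opprB.
suffices /mulmx1_unit[]: (a - 1) *m - (\sum_(i < m) a ^+ i) = 1 by [].
by rewrite mulmxN -[_ *m _]subrX1 A0 sub0r opprK.
Qed.

(** If the sum u is a unit, then x / u and 1 - x / u = y / u are not both
    singular. *)
Lemma singular_add n (rM : mx_representation k G n) (x y : 'M_n) :
  indecomposable rM -> equivariant rM G x -> equivariant rM G y ->
  x \notin unitmx -> y \notin unitmx -> x + y \notin unitmx.
Proof.
move=> indM invx invy nUx; apply: contra => Uxy.
have: 1%:M - invmx (x + y) *m x \in unitmx.
  apply: (indecomposable_sub1_unit indM);
    last by rewrite unitmx_mul negb_and nUx orbT.
  apply: equivariantM => //; apply: equivariant_inv => //.
  exact: equivariantD.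
rewrite -(mulVmx Uxy) mulmxDr addrC addKr unitmx_mul.
by case/andP.
Qed.

Lemma singular_sum n (rM : mx_representation k G n) (I : finType) (P : pred I)
    (F : I -> 'M_n) :
  indecomposable rM -> (forall i, P i -> equivariant rM G (F i)) ->
  (forall i, P i -> F i \notin unitmx) -> \sum_(i | P i) F i \notin unitmx.
Proof.
move=> indM invF nUF.
suffices [] : equivariant rM G (\sum_(i | P i) F i) /\
              \sum_(i | P i) F i \notin unitmx by [].
apply: (big_ind (fun x => equivariant rM G x /\ x \notin unitmx)).
- split; first by rewrite -(raddf0 (@scalar_mx k n)); apply: equivariant_scalar.
  have [n_gt0 _] := indM; rewrite unitmxE unitfE negbK.
  by case: n n_gt0 {rM indM F invF nUF} => // n _; rewrite det0.
- move=> x y [invx nUx] [invy nUy]; split; first exact: equivariantD.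
  exact: (singular_add indM).
by move=> i Pi; split; [apply: invF | apply: nUF].
Qed.

End LocalEndomorphisms.

(** * The adjoint involution of a form *)

Section Adjoint.

Variables (k : fieldType) (gT : finGroupType) (G : {group gT}).
Implicit Types (K H : {group gT}) (g : gT).

Lemma bform_delta n (C : 'M[k]_n) i j :
  bform C (delta_mx i 0) (delta_mx j 0) = C i j.
Proof. by rewrite /bform trmx_delta -rowE -colE !mxE. Qed.

Lemma eq_bform n (B C : 'M[k]_n) :
  (forall u v, bform B u v = bform C u v) -> B = C.
Proof. by move=> eqBC; apply/matrixP=> i j; rewrite -!bform_delta eqBC. Qed.

Lemma GformP n (rM : mx_representation k G n) (B : 'M_n) :
  Gform rM B <-> [/\ B^T = B, B \in unitmx
                   & forall g, g \in G -> (rM g)^T *m B *m rM g = B].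
Proof.
split=> [[symB ndB invB] | [symB UB invB]].
  split.
  - by apply/matrixP=> i j; rewrite mxE -!bform_delta symB.
  - rewrite unitmxE unitfE; apply/det0P=> -[u nz_u uB0].
    case/eqP: nz_u; apply: trmx_inj; rewrite trmx0; apply: ndB => v.
    by rewrite /bform trmxK uB0 mul0mx mxE.
  move=> g Gg; apply/matrixP=> i j.
  by rewrite -!bform_delta -[RHS](invB g Gg) /bform trmx_mul !mulmxA.
split=> [u v | u uB0 | g Gg u v].
- by rewrite /bform -[in LHS]symB -{1}[v]trmxK -mulmxA -!trmx_mul [LHS]mxE.
- have u0: u^T *m B = 0.
    apply: trmx_inj; apply/colP=> i.
    rewrite trmx0 [RHS]mxE -(uB0 (delta_mx i 0)).
    by rewrite /bform -colE !mxE.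
  by apply: trmx_inj; rewrite -(mulmxK UB u^T) u0 mul0mx trmx0.
by rewrite /bform -[in RHS](invB g Gg) trmx_mul !mulmxA.
Qed.

Section FixedForm.

Variables (n : nat) (B : 'M[k]_n).

Definition adjoint x : 'M[k]_n := invmx B *m x^T *m B.

Hypotheses (symB : B^T = B) (UB : B \in unitmx).

Lemma adjointK : involutive adjoint.
Proof.
move=> x; rewrite /adjoint !trmx_mul trmx_inv symB trmxK !mulmxA.
by rewrite (mulVmx UB) mul1mx (mulmxKV UB).
Qed.

Lemma adjoint_mul x y : adjoint (x *m y) = adjoint y *m adjoint x.
Proof. by rewrite /adjoint trmx_mul !mulmxA (mulmxK UB). Qed.

Lemma adjointD x y : adjoint (x + y) = adjoint x + adjoint y.
Proof. by rewrite /adjoint raddfD mulmxDr mulmxDl. Qed.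

Lemma adjoint_scalar c : adjoint c%:M = c%:M.
Proof.
by rewrite /adjoint tr_scalar_mx scalar_mxC -mulmxA mulVmx // mulmx1.
Qed.

Lemma adjoint_unit x : (adjoint x \in unitmx) = (x \in unitmx).
Proof. by rewrite !unitmx_mul unitmx_inv unitmx_tr UB andbT. Qed.

Lemma adjoint_symmetric x : (adjoint x = x) <-> (B *m x)^T = B *m x.
Proof.
rewrite trmx_mul symB /adjoint -mulmxA; split=> [{2}<- | ->].
  by rewrite mulKVmx.
by rewrite mulKmx.
Qed.

Variable rM : mx_representation k G n.
Hypothesis invB : forall g, g \in G -> (rM g)^T *m B *m rM g = B.

Lemma adjoint_repr g : g \in G -> adjoint (rM g) = rM g^-1%g.
Proof.
move=> Gg; apply: (can_inj (mulKmx UB)); rewrite /adjoint -mulmxA mulKVmx //.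
by rewrite -{2}(invB Gg) repr_mxK.
Qed.

Lemma adjoint_act x g : g \in G ->
  adjoint (endo_act rM x g) = endo_act rM (adjoint x) g.
Proof.
move=> Gg; rewrite /endo_act !adjoint_mul !adjoint_repr ?groupV // invgK.
by rewrite mulmxA.
Qed.

Lemma equivariant_adjoint K x : K \subset G ->
  equivariant rM K x -> equivariant rM K (adjoint x).
Proof.
by move=> sKG invx g Kg; rewrite -adjoint_act ?invx // (subsetP sKG).
Qed.

Lemma adjoint_rel_trace K H x : K \subset H -> H \subset G ->
  adjoint (rel_trace rM K H x) = rel_trace rM K H (adjoint x).
Proof.
move=> sKH sHG; rewrite /adjoint raddf_sum mulmx_sumr mulmx_suml /=.
apply: eq_bigr => C KC; apply: adjoint_act.
exact/(subsetP sHG)/(repr_rcosets_in sKH).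
Qed.

End FixedForm.

End Adjoint.

(** Write x = c + j with c an eigenvalue of x, so that j is singular: then
    x + sigma(x) = 2 c + j + sigma(j) = j + sigma(j). *)
Lemma singular_add_adjoint (k : closedFieldType) (gT : finGroupType)
    (G : {group gT}) n (rM : mx_representation k G n) (B x : 'M_n) :
  2%N \in [pchar k] -> indecomposable rM -> B^T = B -> B \in unitmx ->
  (forall g, g \in G -> (rM g)^T *m B *m rM g = B) ->
  equivariant rM G x -> x + adjoint B x \notin unitmx.
Proof.
move=> char2 indM symB UB invB invx; have [n_gt0 _] := indM.
have [c rc]: exists c, root (char_poly x) c.
  by apply/closed_rootP; rewrite size_char_poly eqSS -lt0n.
have nUj: x - c%:M \notin unitmx.
  rewrite -row_free_unit -kermx_eq0.
  by move: rc; rewrite -eigenvalue_root_char.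
have invc := equivariant_scalar rM.
have invj: equivariant rM G (x - c%:M).
  by rewrite -(raddfN (@scalar_mx k n)); exact: equivariantD invx (invc _).
have ->: x + adjoint B x = (x - c%:M) + adjoint B (x - c%:M).
  rewrite -[in LHS](subrK c%:M x) adjointD addrACA adjoint_scalar //.
  by rewrite -raddfD addrr_pchar2 // raddf0 addr0.
apply: (singular_add indM) => //; last by rewrite adjoint_unit.
exact: equivariant_adjoint.
Qed.

(** * Projectivity of forms and traces *)

Section HigmanCriterion.

Variables (k : fieldType) (gT : finGroupType) (G : {group gT}).
Variables (n : nat) (rM : mx_representation k G n).
Variables (H : {group gT}).
Hypothesis sHG : H \subset G.

Definition form_act (A : 'M[k]_n) g := (rM g)^T *m A *m rM g.

Lemma big_rcosets_coset_rep (f : {set gT} -> 'M[k]_n) :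
  \sum_(C in rcosets H G) f C
  = \sum_(i < #|lcosets H G|) f (enum_val i)^-1%g.
Proof.
rewrite -(@big_enum_val _ _ _ _ (mem (lcosets H G)) (fun C => f C^-1%g)).
rewrite (reindex_inj (inv_inj (@invgK {set gT}))) /=; apply: eq_bigl => C.
apply/rcosetsP/lcosetsP=> -[g Gg].
  move/(congr1 (fun D => D^-1%g)); rewrite invgK => ->.
  by exists g^-1%g; rewrite ?groupV // invg_rcoset.
by move=> ->; exists g^-1%g; rewrite ?groupV // invg_lcoset.
Qed.

Lemma coset_rep_G i : @coset_rep gT G H i \in G.
Proof. by rewrite -(mulGSid sHG) coset_rep_mem. Qed.

Lemma form_act_lcoset (A : 'M[k]_n) i :
  (forall h, h \in H -> form_act A h = A) ->
  form_act A (repr (enum_val i)^-1%g) = form_act A (@coset_rep gT G H i)^-1%g.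
Proof.
move=> invA; rewrite -coset_repK invg_lcoset; case: repr_rcosetP => h Hh.
have [Gh Gt] := (subsetP sHG h Hh, coset_rep_G i).
rewrite /form_act repr_mxM ?groupV // trmx_mul -!mulmxA.
by rewrite (mulmxA (rM h)^T) (mulmxA (_ *m A)) -/(form_act A h) invA.
Qed.

Lemma sum_ext_repr m p (rL : mx_representation k H m) g i
    (F : 'I_#|lcosets H G| -> 'M[k]_(m, p)) :
  (g^-1 *: H)%g = enum_val i ->
  \sum_j ext_repr rL (g * coset_rep j)%g *m F j
  = rL (g * coset_rep i)%g *m F i.
Proof.
move=> Di; have mem_gt j : (g * coset_rep j \in H)%g = (j == i).
  rewrite -groupV invMg mem_coset_rep Di (inj_eq enum_val_inj) eq_sym.
  by [].
rewrite (bigD1 i) //= big1 => [|j ne_ji]; last first.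
  by rewrite /ext_repr mem_gt (negPf ne_ji) mul0mx.
by rewrite addr0 /ext_repr mem_gt eqxx.
Qed.

(** Let P i be the component of the isometry X in the summand t_i (x) L of the
    induced module.  The component P i0 at the coset H is H-equivariant, and
    P i = P i0 t_i^-1.  So B is the trace of the pullback of the form on L
    along P i0. *)
Lemma form_projective_trace B : form_projective rM B H ->
  exists A, [/\ A^T = A, forall h, h \in H -> form_act A h = A
             & B = \sum_(C in rcosets H G) form_act A (repr C)].
Proof.
case=> m [rL [BL [/GformP[symL UL invL] [X [eqX isoX]]]]].
have {}eqX g : g \in G -> X *m rM g = ind_repr G rL g *m X.
  by move=> Gg; apply: eq_mulmx_cV => v; rewrite -!mulmxA eqX.
have {isoX} DB: B = X^T *m ind_form G H BL *m X.
  by apply: eq_bform => u v; rewrite -isoX /bform trmx_mul !mulmxA.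
have [i0] := coset_rep_ex (group1 G) (mem_mulg (group1 G) (group1 H)).
rewrite !mul1g => Di0.
have t0: coset_rep i0 = 1%g by rewrite /coset_rep -Di0 repr_group.
pose P i := submxcol X i.
have key g i : g \in G -> (g^-1 *: H)%g = enum_val i ->
  P i0 *m rM g = rL (g * coset_rep i)%g *m P i.
  move=> Gg Di; have /(congr1 (fun Y => submxcol Y i0)) := eqX g Gg.
  rewrite -{1 2}[X]submxcolK mxcol_mul mul_mxblock_mxrow !mxcolK t0 invg1 => ->.
  rewrite -(sum_ext_repr _ P Di); apply: eq_bigr => j _.
  by rewrite mul1g.
pose A := (P i0)^T *m BL *m P i0.
have actA g i : g \in G -> (g^-1 *: H)%g = enum_val i ->
  form_act A g = (P i)^T *m BL *m P i.
  move=> Gg Di; have Hgt: (g * coset_rep i \in H)%g.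
    by rewrite -groupV invMg mem_coset_rep Di.
  rewrite /form_act /A -!mulmxA !(mulmxA (rM g)^T) -trmx_mul (key g i) //.
  by rewrite trmx_mul -!mulmxA (mulmxA (rL _)^T) (mulmxA (_ *m BL)) invL.
exists A; split; first by rewrite !trmx_mul trmxK symL mulmxA.
  move=> h Hh; have Gh := subsetP sHG h Hh.
  by rewrite (actA h i0) // -Di0 lcoset_id ?groupV.
rewrite DB -[in LHS](submxcolK X) tr_mxcol mul_mxrow_mxdiag mul_mxrow_mxcol.
rewrite big_rcosets_coset_rep; apply: eq_bigr => i _.
rewrite -coset_repK invg_lcoset; case: repr_rcosetP => h Hh.
have [Gh Gt] := (subsetP sHG h Hh, coset_rep_G i).
rewrite (actA _ i) ?groupM ?groupV //.
by rewrite invMg invgK lcosetM (lcoset_id (groupVr Hh)) coset_repK.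
Qed.

(** The form A is the restriction to the first summand of the form
    (A B; B 0) on M + M, which is non-degenerate because B is, whatever A.
    Inducing the embedding of that summand gives the isometry. *)
Lemma trace_form_projective B A : Gform rM B -> A^T = A ->
  (forall h, h \in H -> form_act A h = A) ->
  B = \sum_(C in rcosets H G) form_act A (repr C) -> form_projective rM B H.
Proof.
move=> /GformP[symB UB invB] symA invA DB.
pose rLmx g := block_mx (rM g) 0 0 (rM g).
have rL_repr: mx_repr H rLmx.
  split=> [|g h Hg Hh]; first by rewrite /rLmx repr_mx1 -scalar_mx_block.
  have [Gg Gh] := (subsetP sHG g Hg, subsetP sHG h Hh).
  by rewrite /rLmx mulmx_block !mulmx0 !mul0mx !addr0 add0r repr_mxM.
pose rL := MxRepresentation rL_repr; pose BL := block_mx A B B 0.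
have GfL: Gform rL BL.
  apply/GformP; split.
  - by rewrite /BL tr_block_mx symA symB trmx0.
  - have: BL *m block_mx 0 (invmx B) (invmx B)
                         (- (invmx B *m A *m invmx B)) = 1%:M.
      rewrite mulmx_block !mulmx0 !mul0mx !add0r !addr0 mulmxV //.
      by rewrite mulmxN !mulmxA mulmxV // mul1mx addrN -scalar_mx_block.
    by case/mulmx1_unit.
  move=> h Hh; have Gh := subsetP sHG h Hh.
  rewrite /BL /= /rLmx tr_block_mx trmx0 !mulmx_block !mulmx0 !mul0mx.
  by rewrite !addr0 !add0r -/(form_act A h) invA // invB // !mul0mx.
pose P : 'M[k]_(n + n, n) := col_mx 1%:M 0.
pose X := \mxcol_(i < #|lcosets H G|) (P *m rM (coset_rep i)^-1%g).
have PrL h : rL h *m P = P *m rM h.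
  by rewrite mul_block_col mul_col_mx !mulmx1 mul1mx !mulmx0 !mul0mx !addr0.
exists (n + n)%N, rL, BL; split=> //; exists X; split=> [g Gg u | u v].
  rewrite !mulmxA; congr (_ *m u).
  rewrite mul_mxblock_mxrow mxcol_mul; apply: eq_mxcol => i.
  have Gt := coset_rep_G.
  have Gg' : ((coset_rep i)^-1 * g \in G)%g by rewrite groupM ?groupV.
  have [j] := coset_rep_ex (group1 G) (mem_mulg (groupVr Gg') (group1 H)).
  rewrite mul1g mulg1 => Dj.
  rewrite (sum_ext_repr _ (fun j => P *m rM (coset_rep j)^-1%g) Dj).
  by rewrite mulmxA PrL -!mulmxA -!repr_mxM ?groupM ?groupV // mulgK.
suffices DX : B = X^T *m ind_form G H BL *m X.
  by rewrite [in RHS]DX /bform trmx_mul !mulmxA.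
rewrite DB big_rcosets_coset_rep tr_mxcol mul_mxrow_mxdiag mul_mxrow_mxcol.
apply: eq_bigr => i _.
rewrite form_act_lcoset // /form_act trmx_mul -!mulmxA; congr (_ *m _).
rewrite 2!mulmxA; congr (_ *m _).
rewrite /P tr_col_mx mul_row_block trmx1 trmx0 !mul1mx !mul0mx !addr0.
by rewrite mul_row_col mulmx1 mulmx0 addr0.
Qed.

End HigmanCriterion.

Section FormsAsOperators.

Variables (k : fieldType) (gT : finGroupType) (G : {group gT}).
Variables (n : nat) (rM : mx_representation k G n) (B : 'M[k]_n).
Hypothesis GfB : Gform rM B.
Implicit Types (K : {group gT}) (x : 'M[k]_n).

Let symB : B^T = B. Proof. by have /GformP[] := GfB. Qed.
Let UB : B \in unitmx. Proof. by have /GformP[] := GfB. Qed.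
Let invB g : g \in G -> (rM g)^T *m B *m rM g = B.
Proof. by have /GformP[_ _] := GfB; apply. Qed.

Lemma form_act_mul x g : g \in G ->
  form_act rM (B *m x) g = B *m endo_act rM x g.
Proof.
move=> Gg; rewrite /form_act /endo_act -(adjoint_repr UB invB Gg).
rewrite /adjoint !mulmxA.
by rewrite mulmxV // mul1mx.
Qed.

Lemma form_act_trace K x : K \subset G ->
  \sum_(C in rcosets K G) form_act rM (B *m x) (repr C)
  = B *m rel_trace rM K G x.
Proof.
move=> sKG; rewrite mulmx_sumr; apply: eq_bigr => C KC.
by rewrite form_act_mul // (repr_rcosets_in sKG).
Qed.

Lemma form_projective_adjoint_trace K : K \subset G -> form_projective rM B K ->
  exists x, [/\ equivariant rM K x, adjoint B x = x
             & rel_trace rM K G x = 1%:M].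
Proof.
move=> sKG /(form_projective_trace sKG)[A [symA invA DB]].
have DA: A = B *m (invmx B *m A) by rewrite mulKVmx.
exists (invmx B *m A); split.
- move=> g Kg; have Gg := subsetP sKG g Kg.
  by apply: (can_inj (mulKmx UB)); rewrite -form_act_mul // -DA invA.
- by apply/adjoint_symmetric; rewrite // -DA.
apply: (can_inj (mulKmx UB)); rewrite -form_act_trace // mulmx1 [in RHS]DB.
by apply: eq_bigr => C _; rewrite -DA.
Qed.

(** As B' need not be B, a self-adjoint x with a unit trace from K shows that
    M is symmetrically K-projective, whatever B is. *)
Lemma adjoint_trace_form_projective K x : K \subset G ->
  equivariant rM K x -> adjoint B x = x -> rel_trace rM K G x \in unitmx ->
  let B' := B *m rel_trace rM K G x in Gform rM B' /\ form_projective rM B' K.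
Proof.
move=> sKG invx /(adjoint_symmetric symB UB) symx Uu B'.
have GfB': Gform rM B'.
  apply/GformP; split.
  - by apply/adjoint_symmetric; rewrite // (adjoint_rel_trace UB invB) //
         (iffRL (adjoint_symmetric symB UB _) symx).
  - by rewrite unitmx_mul UB.
  move=> g Gg; rewrite -/(form_act rM B' g) form_act_mul //.
  by congr (B *m _); apply: rel_trace_equivariant.
split=> //; apply: (trace_form_projective sKG (A := B *m x)) => //.
  by move=> h Kh; have Gh := subsetP sKG h Kh; rewrite form_act_mul // invx.
by rewrite form_act_trace.
Qed.

End FormsAsOperators.

(** * Cancellation modulo singular endomorphisms *)

Section Cancellation.

Variables (k : closedFieldType) (gT : finGroupType) (G : {group gT}).
Variables (n : nat) (rM : mx_representation k G n) (B : 'M[k]_n).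
Hypotheses (char2 : 2%N \in [pchar k]) (indM : indecomposable rM).
Hypothesis GfB : Gform rM B.
Implicit Types (K V W : {group gT}) (x y : 'M[k]_n) (C : {set gT}).

Let symB : B^T = B. Proof. by have /GformP[] := GfB. Qed.
Let UB : B \in unitmx. Proof. by have /GformP[] := GfB. Qed.
Let invB g : g \in G -> (rM g)^T *m B *m rM g = B.
Proof. by have /GformP[_ _] := GfB; apply. Qed.

(** The terms at c and i c add up to x + sigma(x), hence to a singular element,
    when c is not fixed. *)
Lemma unit_fixed_point (I : finType) (X : {set I}) (i : I -> I)
    (F : I -> 'M_n) :
  {in X, forall c, i c \in X} -> {in X, forall c, i (i c) = c} ->
  {in X, forall c, equivariant rM G (F c)} ->
  {in X, forall c, F (i c) = adjoint B (F c)} ->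
  \sum_(c in X) F c \in unitmx ->
  exists c, [/\ c \in X, i c = c & F c \in unitmx].
Proof.
(* lt selects one point in each orbit of length 2. *)
move=> Xi iK invF Fi; pose lt (c d : I) := (enum_rank c < enum_rank d)%N.
rewrite (bigID (fun c => i c == c)) /=.
have [/existsP[c /and3P[Xc /eqP ic UF]] _ | no_c] :=
  boolP [exists c, [&& c \in X, i c == c & F c \in unitmx]]; first by exists c.
move=> Usum; exfalso; move: Usum; apply/negP; apply: (singular_add indM).
- by apply: equivariant_sum => c /andP[Xc _]; apply: invF.
- by apply: equivariant_sum => c /andP[Xc _]; apply: invF.
- apply: (singular_sum indM) => c /andP[Xc ic]; first exact: invF.
  by apply: contra no_c => UF; apply/existsP; exists c; rewrite Xc ic.
rewrite (bigID (fun c => lt c (i c))) /=.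
have ->: \sum_(c | (c \in X) && (i c != c) && ~~ lt c (i c)) F c
  = \sum_(c | (c \in X) && (i c != c) && lt c (i c)) F (i c).
  rewrite (reindex_onto i i) /= => [|c /andP[/andP[Xc _] _]]; last exact: iK.
  apply: eq_bigl => c; have [Xc | nXc] := boolP (c \in X); last first.
    case: (boolP (i c \in X)) => //= Xic.
    by apply/negbTE; apply: contra nXc => /andP[_ /eqP <-]; apply: Xi.
  rewrite iK // Xi //= eqxx andbT eq_sym; case: eqVneq => //= ne_ic.
  by rewrite /lt -leqNgt leq_eqVlt (inj_eq val_inj) (inj_eq enum_rank_inj)
             eq_sym (negPf ne_ic).
rewrite -big_split /=; apply: (singular_sum indM) => c /andP[/andP[Xc _] _].
  rewrite Fi //; apply: equivariantD; first exact: invF.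
  by apply: (equivariant_adjoint UB invB) => //; apply: invF.
by rewrite Fi //; apply: (singular_add_adjoint char2 indM) => //; apply: invF.
Qed.

(** Such a V is a vertex of M.  Minimality is for unit traces, because a unit
    trace can be normalised to 1. *)
Lemma minimal_trace_group : exists V z,
  [/\ V \subset G, equivariant rM V z, rel_trace rM V G z = 1%:M
    & forall W x, W \proper V -> equivariant rM W x ->
        rel_trace rM W G x \notin unitmx].
Proof.
have descend m : forall V z, V \subset G -> (#|V| < m)%N ->
    equivariant rM V z -> rel_trace rM V G z = 1%:M ->
    exists V z, [/\ V \subset G, equivariant rM V z, rel_trace rM V G z = 1%:M
      & forall W x, W \proper V -> equivariant rM W x ->
          rel_trace rM W G x \notin unitmx].
  elim: m => // m IHm V z sVG leVm invz trz.
  case: (classic (exists W x, [/\ W \proper V, equivariant rM W x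
                                 & rel_trace rM W G x \in unitmx])); last first.
    move=> noW; exists V, z; split=> // W x ltWV invx; apply/negP=> Utr.
    by case: noW; exists W, x.
  case=> W [x [ltWV invx Utr]]; have sWV := proper_sub ltWV.
  have sWG := subset_trans sWV sVG; pose u := rel_trace rM W G x.
  have invu: equivariant rM G (invmx u).
    by apply: equivariant_inv => //; apply: rel_trace_equivariant.
  apply: (IHm W (x *m invmx u)) => //.
  - exact: leq_trans (proper_card ltWV) _.
  - by apply: equivariantM => //; apply: equivariantS invu.
  by rewrite rel_traceMr // mulmxV.
apply: (descend #|G|.+1 G 1%:M) => //; first exact: equivariant1.
by rewrite /rel_trace rcosets_id big_set1 repr_group endo_act1.
Qed.

Section MinimalGroup.

Variables (V : {group gT}) (z : 'M[k]_n).
Hypotheses (sVG : V \subset G) (invz : equivariant rM V z).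
Hypothesis trz : rel_trace rM V G z = 1%:M.
Hypothesis minV : forall W x, W \proper V -> equivariant rM W x ->
  rel_trace rM W G x \notin unitmx.

Notation tr := (rel_trace rM V G).

Lemma tr_equivariant x : equivariant rM V x -> equivariant rM G (tr x).
Proof. exact: rel_trace_equivariant. Qed.

Lemma tr_act x g : g \in G -> g \in 'N(V)%g -> equivariant rM V x ->
  tr (endo_act rM x g) = tr x.
Proof.
move=> Gg Ng invx; rewrite -[RHS](rel_trace_conj sVG (subxx G) Gg invx).
by have ->: (V :^ g)%G = V by apply/group_inj/normP.
Qed.

Lemma adjoint_tr x : adjoint B (tr x) = tr (adjoint B x).
Proof. exact: adjoint_rel_trace. Qed.

Lemma act_equivariant x g : g \in G -> g \in 'N(V)%g -> equivariant rM V x ->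
  equivariant rM V (endo_act rM x g).
Proof.
move=> Gg Ng invx; have := equivariant_conj sVG Gg invx.
by have ->: (V :^ g)%G = V by apply/group_inj/normP.
Qed.

(** The sum over a V-orbit is a trace from a point stabiliser, which is here a
    proper subgroup of V. *)
Lemma tr_moved_singular (Y : {set {set gT}}) (f : {set gT} -> 'M_n) :
  [acts V, on Y | 'Rs] -> {in Y, forall C, ~~ (V \subset 'C[C | 'Rs])%g} ->
  {in Y & V, forall C v, f (C :* v) = endo_act rM (f C) v} ->
  tr (\sum_(C in Y) f C) \notin unitmx /\
  equivariant rM V (\sum_(C in Y) f C).
Proof.
move=> actsV moved fV.
have sum_orbit C : C \in Y -> let W := 'C_V[C | 'Rs]%G in
    \sum_(D in orbit 'Rs V C) f D = rel_trace rM W V (f C) /\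
    equivariant rM W (f C).
  move=> YC W; have sOY: orbit 'Rs V C \subset Y by rewrite acts_sub_orbit.
  split; last first.
    move=> v /setIP[Vv /astab1P cCv]; rewrite -fV //; congr f.
    by rewrite -rcosetE; apply: cCv.
  apply: sum_orbit_rel_trace => // D v OD Vv.
  rewrite /= rcosetE; apply: fV => //.
  exact: (subsetP sOY).
rewrite (set_partition_big _ (orbit_partition actsV)) /=; split; last first.
  apply: equivariant_sum => _ /imsetP[C YC ->].
  have [-> invC] := sum_orbit C YC; apply: rel_trace_equivariant => //.
  exact: subsetIl.
rewrite rel_trace_sum; apply: (singular_sum indM) => _ /imsetP[C YC ->].
  have [-> invC] := sum_orbit C YC.
  apply/tr_equivariant/rel_trace_equivariant => //.
  exact: subsetIl.
have [-> invC] := sum_orbit C YC; rewrite rel_trace_trans ?subsetIl //.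
apply: minV => //; rewrite properE subsetIl /= subsetI subxx; exact: moved.
Qed.

(** Mackey's formula for a product with a trace from K, modulo singular
    endomorphisms: the cosets of K moved by V drop out. *)
Lemma tr_fixed_unit K y x1 x2 : K \subset G -> equivariant rM K y ->
  equivariant rM V x1 -> equivariant rM V x2 ->
  tr (x1 *m rel_trace rM K G y *m x2) \in unitmx ->
  \sum_(C in 'Fix_(rcosets K G | 'Rs)(V))
     tr (x1 *m endo_act rM y (repr C) *m x2) \in unitmx.
Proof.
move=> sKG invy invx1 invx2.
pose f C := x1 *m endo_act rM y (repr C) *m x2.
have f_act C v : C \in rcosets K G -> v \in V ->
    f (C :* v) = endo_act rM (f C) v.
  move=> KC Vv; have Gv := subsetP sVG v Vv.
  by rewrite /f (endo_act_rcosetM sKG invy) // !endo_act_mul // invx1 // invx2.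
rewrite mulmx_sumr mulmx_suml (big_setID ('Fix_('Rs)(V))%act) /= rel_traceD.
set moved := \sum_(C in _ :\: _) _.
have [sing_moved inv_moved] : tr moved \notin unitmx /\ equivariant rM V moved.
  apply: tr_moved_singular => [|C|C v].
  - apply: actsD; first exact: subset_trans sVG (actsRs_rcosets K G).
    by apply: subset_trans (astab_sub _ _); rewrite astabCin ?subsetT.
  - by rewrite inE -sub_astab1 ?subsetT // => /andP[].
  by case/setDP=> KC _; apply: f_act.
rewrite -rel_trace_sum; apply: contraLR => sing_fixed.
apply: (singular_add indM) => //; apply: tr_equivariant => //.
apply: equivariant_sum => C /setIP[KC /afixP fixC] v Vv.
by rewrite -f_act //; congr f; rewrite -rcosetE; apply: fixC.
Qed.

Lemma equivariant_adj x : equivariant rM V x -> equivariant rM V (adjoint B x).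
Proof. exact: equivariant_adjoint. Qed.

Lemma act_square x h : h \in G -> (h * h \in V)%g ->
  equivariant rM V x -> endo_act rM (endo_act rM x h) h = x.
Proof. by move=> Gh Vhh invx; rewrite -endo_actM // invx. Qed.

(** Expand 1 = Tr(sigma(z) Tr(z)) over the V-fixed cosets Vg.  The term
    of Vg^-1 is the adjoint of that of Vg, so one of the cosets with
    Vg^-1 = Vg has a unit term. *)
Lemma exists_swap : exists h, [/\ h \in G, h \in 'N(V)%g, (h * h \in V)%g
  & tr (adjoint B z *m endo_act rM z h) \in unitmx].
Proof.
pose X := ('Fix_(rcosets V G | 'Rs)(V))%act.
pose F C := tr (adjoint B z *m endo_act rM z (repr C)).
have XP C : C \in X ->
    exists g, [/\ g \in G, g \in 'N(V)%g, C = V :* g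
              & F C = tr (adjoint B z *m endo_act rM z g)].
  case/setIP=> /rcosetsP[g Gg ->] /afixP fixC; exists g; split=> //; last first.
    by rewrite /F endo_act_rcoset.
  rewrite -groupV inE; apply/subsetP=> _ /imsetP[v Vv ->].
  rewrite conjgE invgK mulgA -mem_rcoset -(fixC v Vv) /= rcosetE -rcosetM.
  exact: rcoset_refl.
have XI g : g \in G -> g \in 'N(V)%g -> V :* g \in X.
  move=> Gg Ng; rewrite inE rcoset_in_rcosets //=; apply/afixP=> v Vv.
  by rewrite /= rcosetE -rcosetM conjgCV rcosetM rcoset_id // memJ_norm ?groupV.
have invz' := equivariant_adj invz.
have invF g : g \in G -> g \in 'N(V)%g ->
    equivariant rM V (adjoint B z *m endo_act rM z g).
  by move=> Gg Ng; apply: equivariantM => //; apply: act_equivariant.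
have FV g : g \in G -> F (V :* g) = tr (adjoint B z *m endo_act rM z g).
  by move=> Gg; rewrite /F endo_act_rcoset.
have invV g : g \in 'N(V)%g -> ((V :* g)^-1 = V :* g^-1)%g.
  by move=> Ng; rewrite invg_rcoset norm_rlcoset ?groupV.
have UF: \sum_(C in X) F C \in unitmx.
  have := @tr_fixed_unit V z _ 1%:M sVG invz invz' (equivariant1 _ sVG).
  rewrite trz !mulmx1 -adjoint_tr trz adjoint_scalar // unitmx1 => /(_ isT).
  by under eq_bigr do rewrite mulmx1.
have [] := @unit_fixed_point _ X (fun C => C^-1%g) F _ _ _ _ UF.
- by move=> C /XP[g [Gg Ng -> _]]; rewrite invV // XI ?groupV.
- by move=> C _; apply: invgK.
- by move=> C /XP[g [Gg Ng _ ->]]; apply/tr_equivariant/invF.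
- move=> C /XP[g [Gg Ng -> _]]; rewrite invV // !FV ?groupV // adjoint_tr.
  have [Gg' Ng'] : g^-1%g \in G /\ g^-1%g \in 'N(V)%g by rewrite !groupV.
  rewrite -(tr_act Gg Ng (invF _ Gg' Ng')) endo_act_mul // -endo_actM // mulVg.
  rewrite endo_act1 (adjoint_mul UB) (adjointK symB UB).
  by rewrite (adjoint_act UB invB).
move=> _ [/XP[g [Gg Ng -> ->]] Vg Ug]; exists g; split=> //.
have: g^-1%g \in V :* g by rewrite -Vg invV // rcoset_refl.
by rewrite mem_rcoset -invMg groupV.
Qed.

(** Insert 1 = Tr_K^G(y) in the middle of sigma(z) z^h and expand over the
    V-fixed cosets C of K.  Since h^2 is in V, conjugating by h exchanges z and
    z^h, so the term of C h is the adjoint of that of C. *)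
Lemma fixed_by_swap K y h : K \subset G -> equivariant rM K y ->
  adjoint B y = y -> rel_trace rM K G y = 1%:M ->
  h \in G -> h \in 'N(V)%g -> (h * h \in V)%g ->
  tr (adjoint B z *m endo_act rM z h) \in unitmx ->
  exists2 c, c \in G & V <*> <[h]> \subset K :^ c.
Proof.
move=> sKG invy symy try1 Gh Nh Vhh Utr.
pose X := ('Fix_(rcosets K G | 'Rs)(V))%act.
pose F C := tr (adjoint B z *m endo_act rM y (repr C) *m endo_act rM z h).
have invz' := equivariant_adj invz; have invzh := act_equivariant Gh Nh invz.
have XP C : C \in X ->
    C \in rcosets K G /\ equivariant rM V (endo_act rM y (repr C)).
  case/setIP=> KC /afixP fixC; split=> // v Vv; have Gv := subsetP sVG v Vv.
  by rewrite -(endo_act_rcosetM sKG) // -rcosetE [rcoset C v](fixC v Vv).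
have invF C : C \in X -> equivariant rM V
    (adjoint B z *m endo_act rM y (repr C) *m endo_act rM z h).
  by case/XP=> _ invyC; do 2!apply: equivariantM => //.
have UF: \sum_(C in X) F C \in unitmx.
  by apply: tr_fixed_unit => //; rewrite try1 mulmx1.
have [] := @unit_fixed_point _ X (fun C => C :* h) F _ _ _ _ UF.
- move=> C /setIP[KC /afixP fixC]; rewrite inE mem_rcosetsM //=.
  apply/afixP=> v Vv; rewrite /= rcosetE -rcosetM conjgCV rcosetM.
  have := fixC (v ^ h^-1)%g; rewrite /= rcosetE => -> //.
  by rewrite memJ_norm ?groupV.
- move=> C /setIP[KC /afixP fixC]; rewrite -rcosetM -rcosetE.
  exact: (fixC _ Vhh).
- by move=> C XC; apply/tr_equivariant/invF.
- move=> C XC; have [KC invyC] := XP C XC; have GC := repr_rcosets_in sKG KC.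
  rewrite /F (endo_act_rcosetM sKG) // adjoint_tr.
  set yC := endo_act rM y _ in invyC *.
  have symyC: adjoint B yC = yC by rewrite (adjoint_act UB invB) // symy.
  rewrite (adjoint_mul UB (_ *m yC)) (adjoint_mul UB _ yC) symyC.
  rewrite (adjointK symB UB) (adjoint_act UB invB) // mulmxA.
  rewrite -[RHS](tr_act Gh Nh);
    last by do 2!apply: equivariantM => //; apply: act_equivariant.
  by rewrite (endo_act_mul rM _ z) // (endo_act_mul rM _ yC) // act_square.
move=> C [/setIP[/rcosetsP[c Gc DC] /afixP fixC] Ch _]; exists c => //.
have stab g : C :* g = C -> g \in K :^ c.
  rewrite {}DC -rcosetM => Kcg.
  rewrite mem_conjg conjgE invgK mulgA -mem_rcoset.
  by rewrite -Kcg rcoset_refl.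
rewrite join_subG cycle_subG (stab h) // andbT; apply/subsetP=> v Vv.
by apply: stab; rewrite -rcosetE [rcoset C v](fixC v Vv).
Qed.

(** The element w = sigma(z) z^h satisfies sigma(w) = w^h because h^2 is in V,
    and w and w^h have the same trace from V to D since h is in D. *)
Lemma swap_trace h : h \in G -> h \in 'N(V)%g -> (h * h \in V)%g ->
  tr (adjoint B z *m endo_act rM z h) \in unitmx ->
  let D := (V <*> <[h]>)%G in exists x,
    [/\ D \subset G, equivariant rM D x, adjoint B x = x
      & rel_trace rM D G x \in unitmx].
Proof.
move=> Gh Nh Vhh Utr D; pose w := adjoint B z *m endo_act rM z h.
have invz' := equivariant_adj invz; have invzh := act_equivariant Gh Nh invz.
have invw: equivariant rM V w by apply: equivariantM.
have sDG: D \subset G by rewrite join_subG sVG cycle_subG.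
have sVD: V \subset D by rewrite joing_subl.
have Dh: h \in D by rewrite -cycle_subG joing_subr.
exists (rel_trace rM V D w); split=> //.
- exact: rel_trace_equivariant.
- rewrite (adjoint_rel_trace UB invB) // -[RHS](rel_trace_conj sVD sDG Dh invw).
  have ->: (V :^ h)%G = V by apply/group_inj/normP.
  rewrite /w (adjoint_mul UB) (adjointK symB UB) (adjoint_act UB invB) //.
  by rewrite endo_act_mul // act_square.
by rewrite rel_trace_trans.
Qed.

End MinimalGroup.
End Cancellation.

(** * Symmetric vertices *)

(** The trace of x is only a unit, so M affords a D-projective form that may
    differ from B, while the last clause is about B itself. *)
Lemma exists_symmetric_defect (k : closedFieldType) (gT : finGroupType)
    (G : {group gT}) (n : nat) (rM : mx_representation k G n) (B : 'M[k]_n) :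
  2%N \in [pchar k] -> indecomposable rM -> Gform rM B ->
  exists (D : {group gT}) x,
    [/\ D \subset G, equivariant rM D x, adjoint B x = x,
        rel_trace rM D G x \in unitmx
      & forall K : {group gT}, K \subset G -> form_projective rM B K ->
          exists2 c, c \in G & D \subset K :^ c].
Proof.
move=> char2 indM GfB.
have [V [z [sVG invz trz minV]]] := minimal_trace_group rM.
have [h [Gh Nh Vhh Utr]] := exists_swap char2 indM GfB sVG invz trz minV.
have [x [sDG invx symx Ux]] := swap_trace GfB sVG invz Gh Nh Vhh Utr.
exists (V <*> <[h]>)%G, x; split=> // K sKG.
case/(form_projective_adjoint_trace GfB sKG)=> y [invy symy try1].
exact: (fixed_by_swap char2 indM GfB sVG invz minV sKG invy).
Qed.

Theorem theorem1p3 (k : closedFieldType) (gT : finGroupType) (G : {group gT})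
    (n : nat) (rM : mx_representation k G n) (T : {group gT}) (B : 'M[k]_n) :
  2%N \in [pchar k] ->
  ~~ odd #|G| ->
  indecomposable rM ->
  symmetric_type rM ->
  symmetric_vertex rM T ->
  Gform rM B ->
  form_projective rM B T ->
  forall H : {group gT}, H \subset G ->
    (form_projective rM B H <-> exists2 g : gT, g \in G & (T :^ g)%g \subset H).
Proof.
move=> char2 _ indM _ [sTG _ minT] GfB BT H sHG; split=> [BH | [g Gg sTgH]].
  have [D [x [sDG invx symx Ux leD]]] := exists_symmetric_defect char2 indM GfB.
  have [c Gc sDTc] := leD T sTG BT; have [d Gd sDHd] := leD H sHG BH.
  have /GformP[symB UB invB] := GfB; have Gc' := groupVr Gc.
  have sDcT: (D :^ c^-1)%G \subset T by rewrite sub_conjgV.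
  have /group_inj DT: (D :^ c^-1)%G :=: T.
    apply: minT => //; have sDcG := subset_trans sDcT sTG.
    have [||| GfB' B'D] :=
      adjoint_trace_form_projective GfB sDcG (x := endo_act rM x c^-1%g).
    - exact: equivariant_conj.
    - by rewrite (adjoint_act UB invB) // symx.
    - by rewrite rel_trace_conj.
    by exists (B *m rel_trace rM (D :^ c^-1)%G G (endo_act rM x c^-1%g)).
  exists (c * d^-1)%g; first by rewrite groupM ?groupV.
  by rewrite -DT /= -conjsgM mulgA mulVg mul1g sub_conjgV.
have [x [invx symx trx]] := form_projective_adjoint_trace GfB sTG BT.
have /GformP[symB UB invB] := GfB; have sTgG := subset_trans sTgH sHG.
pose y := rel_trace rM (T :^ g)%G H (endo_act rM x g).
have invxg : equivariant rM (T :^ g)%G (endo_act rM x g).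
  exact: equivariant_conj.
have tr_y: rel_trace rM H G y = 1%:M.
  by rewrite rel_trace_trans // rel_trace_conj.
have [||| _] := adjoint_trace_form_projective GfB sHG (x := y).
- exact: rel_trace_equivariant.
- by rewrite (adjoint_rel_trace UB invB) // (adjoint_act UB invB) // symx.
- by rewrite tr_y unitmx1.
by rewrite tr_y mulmx1.
Qed.
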